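(* Assume that $F$ is $\mu$-strongly convex and $\eta$-smooth with $0<\mu<\eta$, that every consensus matrix satisfies the conditions listed in the context, and that the step size is $\beta=1/\eta$. Let $\kappa\ge1$ be an integer and let $$\epsilon\in\Big[\big(1-\tfrac{\mu}{\eta}\big)^{\kappa}\big(F(\mathbf w^{(0)})-F(\mathbf w^* )\big),\ F(\mathbf w^{(0)})-F(\mathbf w^* )\Big).$$ Put $\Phi=N_{J-1}+\cdots+N_1+N_0$ (with $N_0=1$). Then, for every realization of MH-FL, each of the following two conditions is sufficient for $F(\mathbf w^{(\kappa)})-F(\mathbf w^* )\le\epsilon$: 1. For given non-negative constants $\sigma_1,\dots,\sigma_J$, the round criterion $R(\sigma_1,\dots,\sigma_J;k)$ of the context holds for all $k\ge1$, $\epsilon\ge A:=\frac{\eta^2\Phi}{2\mu D^2}\sum_{j=0}^{J-1}\sigma_{j+1}N_j$, and $$\kappa\ \ge\ \left\lceil\frac{\log(\epsilon-A)-\log\big(F(\mathbf w^{(0)})-F(\mathbf w^* )-A\big)}{\log(1-\mu/\eta)}\right\rceil .$$ 2. For a given $\delta$ with $0<\delta\le\mu/\eta$ and given non-negative constants $\sigma_1^{(k)},\dots,\sigma_J^{(k)}$ ($k\ge1$), for all $k\ge1$ one has $$\sum_{j=0}^{J-1}\sigma^{(k)}_{j+1}N_j\le\frac{D^2\mu(\mu-\delta\eta)}{\eta^4\Phi}\big\|\nabla F(\mathbf w^{(k-1)})\big\|^2$$ and the round criterion $R(\sigma_1^{(k)},\dots,\sigma_J^{(k)};k)$ holds, and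 $$\kappa\ \ge\ \left\lceil\frac{\log(\epsilon)-\log\big(F(\mathbf w^{(0)})-F(\mathbf w^* )\big)}{\log(1-\delta)}\right\rceil .$$
   Context: **Network.** Fix an integer $J\ge 1$ (the number of layers below the server). For $0\le j\le J$ let $\mathcal N_j$ be a finite nonempty set (the nodes of layer $j$), $N_j=|\mathcal N_j|$; $\mathcal N_0=\{0\}$ is the main server, so $N_0=1$; $\mathcal N_J$ are the end devices. At each global iteration $k\ge1$, each node $n\in\mathcal N_j$, $0\le j\le J-1$, has a nonempty set of children $\mathcal Q^{(k)}(n)\subseteq\mathcal N_{j+1}$, and the sets $\mathcal Q^{(k)}(n)$, $n\in\mathcal N_j$, partition $\mathcal N_{j+1}$ (they may change with $k$). The cluster below $n$ is denoted $Q(n)$; its node set at iteration $k$ is $\mathcal Q^{(k)}(n)$. Thus clusters of layer $j+1$ are in bijection with nodes of layer $j$. At iteration $k$ each cluster $C$ operates either in LUT mode or in EUT mode. **Loss.** Each end device $n\in\mathcal N_J$ has a finite nonempty dataset $\mathcal D_n$ and a differentiable local loss $f_n:\mathbb R^M\to\mathbb R$. Put $D=\sum_{n\in\mathcal N_J}|\mathcal D_n|$, $F(\mathbf w)=\frac1D\sum_{n\in\mathcal N_J}|\mathcal D_n|f_n(\mathbf w)$, and $\mathbf w^*=\arg\min_{\mathbf w\in\mathbb R^M}F(\mathbf w)$. $\mu$-strong convexity: $F(\mathbf y)\ge F(\mathbf x)+(\mathbf y-\mathbf x)^\top\nabla F(\mathbf x)+\frac\mu2\|\mathbf y-\mathbf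 x\|^2$ for all $\mathbf x,\mathbf y$; $\eta$-smoothness: $\|\nabla F(\mathbf x)-\nabla F(\mathbf y)\|\le\eta\|\mathbf x-\mathbf y\|$ for all $\mathbf x,\mathbf y$. $\|\cdot\|$ is the Euclidean norm. **Consensus matrices.** For a cluster $C$ with node set $\mathcal C^{(k)}$ that is LUT at iteration $k$, there is a connected undirected graph $G_C^{(k)}$ on $\mathcal C^{(k)}$, a number of device-to-device (D2D) rounds $\theta^{(k)}_C\in\{0,1,2,\dots\}$, and a real matrix $\mathbf V^{(k)}_C$ indexed by $\mathcal C^{(k)}$ with: (i) $(\mathbf V_C^{(k)})_{m,n}=0$ if $m\ne n$ are not adjacent in $G_C^{(k)}$; (ii) $\mathbf V_C^{(k)}\mathbf 1=\mathbf 1$; (iii) $\mathbf V_C^{(k)}$ is symmetric; (iv) the spectral radius satisfies $\rho\big(\mathbf V_C^{(k)}-\mathbf 1\mathbf 1^\top/|\mathcal C^{(k)}|\big)\le\lambda^{(k)}_C$ for a given number $0<\lambda_C^{(k)}<1$. **MH-FL.** Start from $\mathbf w^{(0)}\in\mathbb R^M$. At iteration $k\ge1$, each end device $n\in\mathcal N_J$ computes $\mathbf w_n^{(k)}=\mathbf w^{(k-1)}-\beta\nabla f_n(\mathbf w^{(k-1)})$ and sets its scaled parameter $\widetilde{\mathbf w}^{(k)}_n=|\mathcal D_n|\mathbf w^{(k)}_n$. Then for $j=J-1,J-2,\dots,0$ each node $n\in\mathcal N_j$ with child cluster $C=Q(n)$ obtains $\widetilde{\mathbf w}_n^{(k)}$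 as follows. If $C$ is EUT: $\widetilde{\mathbf w}_n^{(k)}=\sum_{i\in\mathcal Q^{(k)}(n)}\widetilde{\mathbf w}^{(k)}_i$. If $C$ is LUT: let $\widetilde{\mathbf W}_C^{(k)}$ be the matrix whose rows are $\widetilde{\mathbf w}_i^{(k)}$, $i\in\mathcal Q^{(k)}(n)$, let $\widehat{\mathbf W}_C^{(k)}=(\mathbf V_C^{(k)})^{\theta_C^{(k)}}\widetilde{\mathbf W}_C^{(k)}$ with rows $\widehat{\mathbf w}_i^{(k)}$; the parent samples one (arbitrary) child $n'\in\mathcal Q^{(k)}(n)$ and sets $\widetilde{\mathbf w}_n^{(k)}=|\mathcal Q^{(k)}(n)|\,\widehat{\mathbf w}_{n'}^{(k)}$. Finally the server sets $\mathbf w^{(k)}=\widetilde{\mathbf w}_0^{(k)}/D$. A realization is any choice of the sampled children. **Divergence.** For each cluster $C$ and iteration $k$, $\Upsilon_C^{(k)}$ is a number with $\|\widetilde{\mathbf w}_q^{(k)}-\widetilde{\mathbf w}_{q'}^{(k)}\|\le\Upsilon_C^{(k)}$ for all $q,q'\in\mathcal C^{(k)}$. **Round criterion $R(s_1,\dots,s_J;k)$** (for $s_j\ge0$): for every layer $1\le j\le J$ and every cluster $C$ of layer $j$ that is LUT at iteration $k$, $$\theta_C^{(k)}\ge\left\lceil\frac{\log(s_j)-2\log\big(|\mathcal C^{(k)}|^{3/2}\Upsilon_C^{(k)}\big)}{2\log\big(\lambda_C^{(k)}\big)}\right\rceil\ \text{ if } s_j\le|\mathcal C^{(k)}|^3(\Upsilon_C^{(k)})^2,$$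 and $\theta_C^{(k)}\ge0$ otherwise. Convention: $\log0=-\infty$; if $s_j=0<\Upsilon_C^{(k)}$ the lower bound is $+\infty$ (not satisfiable by a finite number of rounds); if $s_j=0=\Upsilon_C^{(k)}$ the condition is read as $\theta_C^{(k)}\ge0$. Likewise, if $\epsilon=A$ in condition 1 the lower bound on $\kappa$ is $+\infty$ (not satisfiable). *)

(* Defs.v *)
From HB Require Import structures.
From mathcomp Require Import all_boot all_order all_algebra.
From mathcomp Require Import all_classical all_reals all_analysis.
From mathcomp Require Import complex.
Set Implicit Arguments.
Unset Strict Implicit.
Unset Printing Implicit Defensive.
Import Order.TTheory GRing.Theory Num.Theory.
Import numFieldNormedType.Exports.
Local Open Scope classical_set_scope.
Local Open Scope ring_scope.

(* The norm that the library puts on ['rV[R]_M] is the sup norm. *)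
Definition norm2 (R : realType) (M : nat) (v : 'rV[R]_M) : R :=
  Num.sqrt (\sum_i v 0 i ^+ 2).

Definition dotp (R : realType) (M : nat) (u v : 'rV[R]_M) : R :=
  \sum_i u 0 i * v 0 i.

Definition grad (R : realType) (M : nat) (F : 'rV[R]_M -> R) (x : 'rV[R]_M) :
    'rV[R]_M :=
  \row_i 'D_(delta_mx 0 i) F x.

Definition strongly_convex (R : realType) (M : nat) (mu : R)
    (F : 'rV[R]_M -> R) : Prop :=
  forall x y, F x + dotp (y - x) (grad F x) + mu / 2 * norm2 (y - x) ^+ 2 <= F y.

Definition smooth (R : realType) (M : nat) (eta : R)
    (F : 'rV[R]_M -> R) : Prop :=
  forall x y, norm2 (grad F x - grad F y) <= eta * norm2 (x - y).

(* Largest modulus of a complex eigenvalue. *)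
Definition spectral_radius (R : realType) (n : nat) (A : 'M[R]_n) : R :=
  sup [set ComplexField.Normc.normc z |
        z in [set z : R[i] | eigenvalue (map_mx (real_complex R) A) z]].

(* A cluster of layer [j.+1] at iteration [k] is named by its parent
   [n : node j]; its node set is [children k n].  Layers beyond [J] carry no
   constraint and are never used; iterations start at [1]. *)
Record network (J : nat) := Network {
  node : nat -> finType;
  server : node 0;
  children : nat -> forall j, node j -> {set node j.+1};
  card_node0 : #|node 0| = 1%N;
  node_nonempty : forall j, (j <= J)%N -> (0 < #|node j|)%N;
  children_nonempty : forall k j (n : node j), (0 < k)%N -> (j < J)%N ->
    children k n != finset.set0;
  children_disjoint : forall k j (n n' : node j), (0 < k)%N -> (j < J)%N ->
    n != n' -> (children k n :&: children k n')%SET = finset.set0;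
  children_cover : forall k j, (0 < k)%N -> (j < J)%N ->
    (\bigcup_(n : node j) children k n)%SET = [set: node j.+1]%SET
}.
Arguments server {J net} : rename.
Arguments children {J net} k {j} _ : rename.

(* Graphs and matrices on a cluster are indexed by ['I_#|children k n|] through
   [enum_val].  [is_lut k n = false] means that the cluster is in EUT mode, in
   which case the other fields are irrelevant. *)
Record consensus (R : realType) (J : nat) (net : network J) := Consensus {
  is_lut : nat -> forall j, node net j -> bool;
  adj : forall (k j : nat) (n : node net j), rel 'I_#|children k n|;
  rounds : nat -> forall j, node net j -> nat;
  mixing : forall (k j : nat) (n : node net j), 'M[R]_#|children k n|;
  rate : nat -> forall j, node net j -> R
}.
Arguments is_lut {R J net} c k {j} n.
Arguments adj {R J net} c k {j} n.
Arguments rounds {R J net} c k {j} n.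
Arguments mixing {R J net} c k {j} n.
Arguments rate {R J net} c k {j} n.

Definition consensus_matrix (R : realType) (c : nat) (G : rel 'I_c)
    (V : 'M[R]_c) (lam : R) : Prop :=
  let ones : 'cV[R]_c := const_mx 1 in
  [/\ forall m n, m != n -> ~~ G m n -> V m n = 0,
      V *m ones = ones,
      V^T = V
    & spectral_radius (V - c%:R^-1 *: (ones *m ones^T)) <= lam].

Definition consensus_valid (R : realType) (J : nat) (net : network J)
    (cs : consensus R net) : Prop :=
  forall k j (n : node net j), (0 < k)%N -> (j < J)%N -> is_lut cs k n ->
    [/\ symmetric (adj cs k n),
        forall a b, connect (adj cs k n) a b,
        0 < rate cs k n < 1
      & consensus_matrix (adj cs k n) (mixing cs k n) (rate cs k n)].

Definition data_size (R : realType) (J : nat) (net : network J)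
    (data : node net J -> finType) : R :=
  \sum_(n : node net J) #|data n|%:R.

Definition global_loss (R : realType) (M J : nat) (net : network J)
    (data : node net J -> finType) (f : node net J -> 'rV[R]_M -> R)
    (x : 'rV[R]_M) : R :=
  (data_size R data)^-1 * \sum_(n : node net J) #|data n|%:R * f n x.

(* [wt j m] is the scaled parameter of node [m] of layer [j]. *)
Definition aggregates (R : realType) (M J : nat) (net : network J)
    (cs : consensus R net) (k : nat) (wt : forall j, node net j -> 'rV[R]_M)
    (j : nat) (n : node net j) : Prop :=
  let c := #|children k n| in
  let W : 'M[R]_(c, M) := \matrix_(i < c) wt j.+1 (enum_val i) in
  if is_lut cs k n then
    exists i : 'I_c,
      wt j n = c%:R *: row i (mixing cs k n ^+ rounds cs k n *m W)
  else wt j n = \sum_(m in children k n) wt j.+1 m.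

(* [(w, wt)] is a realization of the algorithm: [w k] is the server's parameter
   after iteration [k], and the sampled children are the existential witnesses
   in [aggregates]. *)
Definition realization (R : realType) (M J : nat) (net : network J)
    (cs : consensus R net) (data : node net J -> finType)
    (f : node net J -> 'rV[R]_M -> R) (beta : R)
    (w : nat -> 'rV[R]_M)
    (wt : nat -> forall j, node net j -> 'rV[R]_M) : Prop :=
  forall k, (0 < k)%N ->
  [/\ forall n : node net J, wt k J n =
        #|data n|%:R *: (w k.-1 - beta *: grad (f n) (w k.-1)),
      forall j (n : node net j), (j < J)%N -> aggregates cs k (wt k) n
    & w k = (data_size R data)^-1 *: wt k 0%N server].

Definition divergence_bound (R : realType) (M J : nat) (net : network J)
    (wt : nat -> forall j, node net j -> 'rV[R]_M)
    (Ups : nat -> forall j, node net j -> R) : Prop :=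
  forall k j (n : node net j), (0 < k)%N -> (j < J)%N ->
  forall q q', q \in children k n -> q' \in children k n ->
    norm2 (wt k j.+1 q - wt k j.+1 q') <= Ups k j n.

(* [ceil ((log x - b) / d) <= n] for [0 <= x] and [d < 0], with
   [log 0 = -oo]: at [x = 0] the left-hand side is [+oo].  The library has
   [ln 0 = 0], hence the first conjunct. *)
Definition ceil_log_le (R : realType) (x b d : R) (n : nat) : Prop :=
  0 < x /\ Num.ceil ((ln x - b) / d) <= n%:Z.

(* Case [s = 0 = Ups] imposes nothing; case [s = 0 < Ups] is unsatisfiable. *)
Definition cluster_criterion (R : realType) (s : R) (c : nat) (Ups lam : R)
    (theta : nat) : Prop :=
  s <= c%:R ^+ 3 * Ups ^+ 2 ->
  (s = 0 /\ Ups = 0) \/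
  ceil_log_le s (2 * ln (c%:R `^ (3 / 2) * Ups)) (2 * ln lam) theta.

Definition round_criterion (R : realType) (J : nat) (net : network J)
    (cs : consensus R net) (Ups : nat -> forall j, node net j -> R)
    (s : nat -> R) (k : nat) : Prop :=
  forall j (n : node net j), (j < J)%N -> is_lut cs k n ->
    cluster_criterion (s j.+1) #|children k n| (Ups k j n)
      (rate cs k n) (rounds cs k n).

(* Main.v *)
(* One iteration is a gradient step of length [1 / eta] perturbed by an error
   [e].  Telescoping over the layers, [D e] is the sum over all clusters of the
   differences between what the parent stores and the sum over its children.
   In a LUT cluster with [c] nodes, [V - 1 1^T / c] is symmetric with spectral
   radius at most [lambda], so the difference after [theta] rounds has squared
   norm at most [c^3 Ups^2 lambda^(2 theta)], which the round criterion bounds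
   by [sigma].  By Cauchy-Schwarz over the [Phi] clusters,
   [|e|^2 <= Phi / D^2 sum_j sigma_(j+1) N_j].  The descent lemma then gives
   [F (w_k) <= F (w_(k-1)) - |grad F|^2 / (2 eta) + eta / 2 |e|^2], and the
   Polyak-Lojasiewicz inequality turns this into a contraction of [gap - A] by
   [1 - mu / eta] in the first case, of [gap] by [1 - delta] in the second. *)
Require Import Defs.
From HB Require Import structures.
From mathcomp Require Import all_boot all_order all_algebra.
From mathcomp Require Import all_classical all_reals all_analysis.
From mathcomp Require Import complex.
From mathcomp Require Import ring lra.
Set Implicit Arguments.
Unset Strict Implicit.
Unset Printing Implicit Defensive.
Import Order.TTheory GRing.Theory Num.Theory.
Import numFieldNormedType.Exports.
Local Open Scope classical_set_scope.
Local Open Scope ring_scope.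

(** * Euclidean inner product and norm on row vectors *)

Section EuclideanNorm.
Variables (R : realType) (M : nat).
Implicit Types u v : 'rV[R]_M.

Lemma dotpDl u u' v : dotp (u + u') v = dotp u v + dotp u' v.
Proof.
by rewrite /dotp -big_split; apply: eq_bigr => i _; rewrite mxE mulrDl.
Qed.

Lemma dotpZl a u v : dotp (a *: u) v = a * dotp u v.
Proof. by rewrite /dotp mulr_sumr; apply: eq_bigr => i _; rewrite mxE mulrA. Qed.

Lemma dotpC u v : dotp u v = dotp v u.
Proof. by apply: eq_bigr => i _; rewrite mulrC. Qed.

Lemma dotpDr u v v' : dotp u (v + v') = dotp u v + dotp u v'.
Proof. by rewrite dotpC dotpDl !(dotpC u). Qed.

Lemma dotpZr a u v : dotp u (a *: v) = a * dotp u v.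
Proof. by rewrite dotpC dotpZl dotpC. Qed.

Lemma dotpNl u v : dotp (- u) v = - dotp u v.
Proof. by rewrite -scaleN1r dotpZl mulN1r. Qed.

Lemma dotpp_ge0 u : 0 <= dotp u u.
Proof. by apply: sumr_ge0 => i _; rewrite -expr2 sqr_ge0. Qed.

Lemma norm2_ge0 u : 0 <= norm2 u.
Proof. exact: sqrtr_ge0. Qed.

Lemma sqr_norm2 u : norm2 u ^+ 2 = dotp u u.
Proof.
rewrite sqr_sqrtr; last by apply: sumr_ge0 => i _; exact: sqr_ge0.
by apply: eq_bigr => i _; rewrite expr2.
Qed.

Lemma norm20 : norm2 (0 : 'rV[R]_M) = 0.
Proof. by rewrite /norm2 big1 ?sqrtr0// => i _; rewrite mxE expr0n. Qed.

Lemma norm2Z a u : norm2 (a *: u) = `|a| * norm2 u.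
Proof.
apply: (@pexpIrn _ 2) => //; rewrite ?nnegrE ?mulr_ge0 ?norm2_ge0//.
by rewrite exprMn real_normK ?num_real// !sqr_norm2 dotpZl dotpZr expr2 mulrA.
Qed.

Lemma norm2N u : norm2 (- u) = norm2 u.
Proof. by rewrite -scaleN1r norm2Z normrN1 mul1r. Qed.

Lemma norm2_eq0 u : norm2 u = 0 -> u = 0.
Proof.
move=> u0; have duu : dotp u u = 0 by rewrite -sqr_norm2 u0 expr0n.
apply/rowP => i; rewrite mxE; apply/eqP; rewrite -sqrf_eq0 expr2; apply/eqP.
by apply: (psumr_eq0P _ duu) => // j _; rewrite -expr2 sqr_ge0.
Qed.

(** Cauchy-Schwarz: the square of [norm2 v *: u - norm2 u *: v] expands to twice [norm2 u * norm2 v]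
    times the difference of the two sides. *)
Lemma dotp_le u v : dotp u v <= norm2 u * norm2 v.
Proof.
have dotp0 x : dotp 0 x = 0 by rewrite /dotp big1// => i _; rewrite mxE mul0r.
have [/norm2_eq0->|un0] := eqVneq (norm2 u) 0.
  by rewrite dotp0 norm20 mul0r.
have [/norm2_eq0->|vn0] := eqVneq (norm2 v) 0.
  by rewrite dotpC dotp0 norm20 mulr0.
have uv_gt0 : 0 < norm2 u * norm2 v.
  by rewrite mulr_gt0// lt_def ?un0 ?vn0 norm2_ge0.
have := dotpp_ge0 (norm2 v *: u - norm2 u *: v).
rewrite -!scaleNr !dotpDl !dotpDr !dotpZl !dotpZr (dotpC v u) -!sqr_norm2 => H.
by rewrite -subr_ge0 -(pmulr_rge0 _ uv_gt0); lra.
Qed.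

Lemma norm2D u v : norm2 (u + v) <= norm2 u + norm2 v.
Proof.
rewrite -(@ler_pXn2r _ 2)// ?nnegrE ?addr_ge0 ?norm2_ge0//.
rewrite sqrrD !sqr_norm2 dotpDl !dotpDr (dotpC v u) mulr2n.
have := dotp_le u v; lra.
Qed.

Lemma norm2_sum (I : Type) (r : seq I) (P : pred I) (a : I -> 'rV[R]_M) :
  norm2 (\sum_(i <- r | P i) a i) <= \sum_(i <- r | P i) norm2 (a i).
Proof.
apply: (big_ind2 (fun u x => norm2 u <= x)) => //; first by rewrite norm20.
by move=> u x v y ux vy; rewrite (le_trans (norm2D u v))// lerD.
Qed.

End EuclideanNorm.

(** * Norm bounds from the spectral radius *)

Section SpectralBound.
Local Open Scope sesquilinear_scope.

(** By the spectral theorem [A] is diagonal in a unitary basis, and the unitary change of basis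
    preserves the sum of squared moduli. *)
Lemma normal_mulmx_le (C : numClosedFieldType) (n : nat) (A : 'M[C]_n) (l : C)
    (u : 'rV[C]_n) :
  A \is normalmx -> 0 <= l -> (forall z, eigenvalue A z -> `|z| <= l) ->
  \sum_i `|(u *m A) 0 i| ^+ 2 <= l ^+ 2 * \sum_i `|u 0 i| ^+ 2.
Proof.
move=> /orthomx_spectralP; set P := spectralmx A; set d := spectral_diag A.
move=> AE l_ge0 lP.
have Pu : P \is unitarymx := spectral_unitarymx A.
have Punit : P \in unitmx := spectral_unit A.
have sumE (v : 'rV[C]_n) : \sum_i `|v 0 i| ^+ 2 = (v *m v^t*) 0 0.
  by rewrite mxE; apply: eq_bigr => i _; rewrite !mxE normCK.
have isoP (v : 'rV[C]_n) :
    \sum_i `|(v *m P) 0 i| ^+ 2 = \sum_i `|v 0 i| ^+ 2.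
  by rewrite !sumE trmx_mul map_mxM mulmxA mulmxtVK.
(* Row [i] of [P] is a left eigenvector of [A] for [d 0 i], nonzero because [P] is invertible. *)
have dP i : `|d 0 i| <= l.
  apply: lP; apply/eigenvalueP; exists (row i P).
    rewrite {1}AE -row_mul !mulmxA mulmxV// mul1mx.
    by rewrite row_mul row_diag_mx -scalemxAl -rowE.
  apply/eqP => /(congr1 (mulmx^~ (invmx P))); rewrite -row_mul mulmxV// mul0mx.
  by move=> /rowP/(_ i); rewrite !mxE eqxx => /eqP; rewrite oner_eq0.
pose v := u *m invmx P.
have -> : \sum_i `|u 0 i| ^+ 2 = \sum_i `|v 0 i| ^+ 2.
  by rewrite -[RHS]isoP /v mulmxKV.
rewrite AE !mulmxA isoP -/v mulr_sumr; apply: ler_sum => i _.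
rewrite mul_mx_diag mxE normrM exprMn mulrC ler_wpM2r ?exprn_ge0//.
by rewrite lerXn2r ?nnegrE.
Qed.

(** Over [R[i]] a real symmetric matrix is Hermitian, hence normal, so the complex bound applies and
    restricts to real vectors. *)
Lemma symmetric_spectral_le (R : realType) (n : nat) (A : 'M[R]_n) (l : R)
    (u : 'rV[R]_n) :
  A^T = A -> 0 <= l -> spectral_radius A <= l ->
  norm2 (u *m A) <= l * norm2 u.
Proof.
move=> symA l_ge0 rho_le; set Ac := map_mx (real_complex R) A.
have normE (z : R[i]) : `|z| = (ComplexField.Normc.normc z)%:C%C.
  by rewrite normc_def; case: z.
have eig_le (z : R[i]) : eigenvalue Ac z -> `|z| <= l%:C%C.
  move=> zA; rewrite normE lecR; apply: le_trans rho_le; apply: ub_le_sup.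
    (* An unbounded set would have [sup] equal to [0]. *)
    have [r rE] := closed_field_poly_normal (char_poly Ac).
    exists (\sum_(x <- r) ComplexField.Normc.normc x) => _ [x /= + <-].
    rewrite eigenvalue_root_char rE.
    rewrite rootZ ?lead_coef_eq0 ?monic_neq0 ?char_poly_monic//.
    rewrite root_prod_XsubC => xr.
    rewrite (big_rem x)//= lerDl; apply: sumr_ge0 => y _.
    by case: y => a b; exact: sqrtr_ge0.
  by exists z.
have nA : Ac \is normalmx.
  apply: hermitian_normalmx; apply: realsym_hermsym.
    apply/is_hermitianmxP/matrixP => i j.
    by rewrite expr0 scale1r !mxE /= -[in LHS]symA mxE.
  by apply/mxOverP => i j; rewrite mxE; apply/complex_realP; exists (A i j).
have := normal_mulmx_le (map_mx (real_complex R) u) nA _ eig_le.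
rewrite -map_mxM lecR => /(_ l_ge0).
have sumE (v : 'rV[R]_n) :
    \sum_i `|map_mx (real_complex R) v 0 i| ^+ 2 = (norm2 v ^+ 2)%:C%C.
  rewrite sqr_norm2 /dotp rmorph_sum; apply: eq_bigr => i _.
  by rewrite mxE normc_def /= expr0n addr0 -rmorphXn sqr_sqrtr ?sqr_ge0// expr2.
rewrite !sumE -rmorphXn -rmorphM lecR -exprMn ler_pXn2r// nnegrE ?norm2_ge0//.
by rewrite mulr_ge0 ?norm2_ge0.
Qed.

End SpectralBound.

(** * Consensus error within one cluster *)

(** Weighted Cauchy-Schwarz, from the nonnegative double sum of [p i * p j * (s i - s j) ^+ 2]. The
    weights are [1] inside a cluster and the layer sizes across layers. *)
Lemma sqr_sum_le (R : realDomainType) (I : Type) (r : seq I) (p s : I -> R) :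
  (forall i, 0 <= p i) ->
  (\sum_(i <- r) p i * s i) ^+ 2 <=
    (\sum_(i <- r) p i) * \sum_(i <- r) p i * s i ^+ 2.
Proof.
move=> p_ge0.
have E i j : p i * p j * (s i - s j) ^+ 2 =
    p i * s i ^+ 2 * p j + p i * (p j * s j ^+ 2) -
    2 * (p i * s i) * (p j * s j) by ring.
have: 0 <= \sum_(i <- r) \sum_(j <- r) p i * p j * (s i - s j) ^+ 2.
  by apply: sumr_ge0 => i _; apply: sumr_ge0 => j _; rewrite mulr_ge0 ?sqr_ge0// mulr_ge0.
under eq_bigr => i _ do under eq_bigr => j _ do rewrite E.
under eq_bigr => i _ do rewrite big_split sumrN big_split/= -!mulr_sumr.
by rewrite big_split sumrN big_split/= -!mulr_suml -mulr_sumr; lra.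
Qed.

(** In the factor [c ^+ 3], two powers come from scaling the sampled row by [c], the third from
    Cauchy-Schwarz over the [c] rows. *)
Lemma consensus_error (R : realType) (c M : nat) (V : 'M[R]_c) (lam Ups : R)
    (t : nat) (W : 'M[R]_(c, M)) (i : 'I_c) (G : rel 'I_c) :
  consensus_matrix G V lam -> 0 <= lam ->
  (forall a b, norm2 (row a W - row b W) <= Ups) ->
  norm2 (c%:R *: row i (V ^+ t *m W) - \sum_a row a W) ^+ 2 <=
    c%:R ^+ 3 * Ups ^+ 2 * lam ^+ (2 * t).
Proof.
case=> _ V1 symV rho_le lam_ge0 Wdiv.
have c_neq0 : c%:R != 0 :> R.
  by rewrite pnatr_eq0 -lt0n (leq_ltn_trans _ (ltn_ord i)).
have Ups_ge0 : 0 <= Ups by rewrite (le_trans _ (Wdiv i i))// norm2_ge0.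
set ones : 'cV[R]_c := const_mx 1 in V1 rho_le *.
set A := c%:R^-1 *: (ones *m ones^T) in rho_le.
have ones_ones : ones^T *m ones = c%:R%:M.
  apply/matrixP => a b; rewrite !mxE !ord1 eqxx mulr1n.
  under eq_bigr do rewrite !mxE mulr1.
  by rewrite sumr_const card_ord.
have onesV : ones^T *m V = ones^T by rewrite -{1}symV -trmx_mul V1.
have VA : V *m A = A by rewrite -scalemxAr mulmxA V1.
have AV : A *m V = A by rewrite -scalemxAl -mulmxA onesV.
have AA : A *m A = A.
  rewrite {1}/A -scalemxAl -mulmxA -scalemxAr mulmxA ones_ones.
  by rewrite mul_scalar_mx scalerA mulVf// scale1r.
(* The factor [1 - A] makes the identity hold at [t = 0] too, where [(V - A) ^+ 0] is [1] and not
   [1 - A]. *)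
have powE : (V - A) ^+ t *m (1%:M - A) = V ^+ t - A.
  elim: t => [|t IH]; first by rewrite !expr0 mul1mx.
  rewrite exprS -mulmxA IH mulmxBl !mulmxBr AA VA.
  suff -> : A *m V ^+ t = A by rewrite subrr subr0 exprS.
  by elim: t {IH} => [|t IH]; rewrite ?expr0 ?mulmx1// exprS mulmxA AV.
have rowA a : row a (A *m W) = c%:R^-1 *: \sum_b row b W.
  apply/rowP => b; rewrite !mxE summxE mulr_sumr; apply: eq_bigr => d _.
  by rewrite !mxE big_ord1 !mxE !mulr1.
(* The sampled row deviates from the average row by row [i] of
   [(V - A)^t (1 - A) W]: [V - A] contracts, [1 - A] centers the rows. *)
set X := (1%:M - A) *m W; set u := row i ((V - A) ^+ t).
have -> : c%:R *: row i (V ^+ t *m W) - \sum_a row a W = c%:R *: (u *m X).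
  rewrite -row_mul mulmxA powE mulmxBl linearB /= rowA scalerBr scalerA.
  by rewrite divff// scale1r.
(* A centered row is the mean of its differences with all rows, each of norm at most [Ups]. *)
have X_le a : norm2 (row a X) <= Ups.
  have -> : row a X = c%:R^-1 *: \sum_b (row a W - row b W).
    rewrite /X mulmxBl mul1mx linearB /= rowA sumrB sumr_const card_ord.
    by rewrite scalerBr -[row a W *+ c]scaler_nat scalerA mulVf// scale1r.
  rewrite norm2Z ger0_norm ?invr_ge0// mulrC ler_pdivrMr ?lt0r ?c_neq0 ?ler0n//.
  apply: le_trans (norm2_sum _ _ _) _.
  rewrite (le_trans (ler_sum _ (fun b _ => Wdiv a b)))//.
  by rewrite sumr_const card_ord mulr_natr.
(* At [t = 0] the row [u] is a unit basis vector; each further factor [V - A] shrinks it by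
   [lam]. *)
have u_le : norm2 u <= lam ^+ t.
  rewrite /u; elim: t {powE u} => [|t IH].
    rewrite /norm2 (bigD1 i)//= big1 ?addr0 => [|a ai]; rewrite !mxE.
      by rewrite eqxx expr1n sqrtr1.
    by rewrite eq_sym (negbTE ai) expr0n.
  rewrite exprSr row_mul exprS.
  apply: le_trans (symmetric_spectral_le _ _ lam_ge0 rho_le) _.
    by rewrite linearB /= symV linearZ /= trmx_mul trmxK.
  by rewrite ler_wpM2l.
have uX_le : norm2 (u *m X) ^+ 2 <= c%:R * (norm2 u ^+ 2 * Ups ^+ 2).
  have: norm2 (u *m X) <= \sum_a 1 * (`|u 0 a| * Ups).
    rewrite mulmx_sum_row; apply: le_trans (norm2_sum _ _ _) _.
    by apply: ler_sum => a _; rewrite norm2Z mul1r ler_wpM2l.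
  rewrite -(@ler_pXn2r _ 2)// ?nnegrE ?norm2_ge0//; last first.
    by apply: sumr_ge0 => a _; rewrite mul1r mulr_ge0.
  move=> /le_trans; apply; apply: le_trans (sqr_sum_le _ _ _) _ => //.
  rewrite sumr_const card_ord sqr_norm2 /dotp mulr_suml.
  apply: ler_wpM2l => //; apply: ler_sum => a _.
  by rewrite mul1r exprMn real_normK ?num_real// expr2.
have factorE (x y z : R) : x ^+ 3 * y * z = x ^+ 2 * (x * (z * y)) by ring.
rewrite factorE norm2Z exprMn ger0_norm// ler_wpM2l ?sqr_ge0//.
apply: le_trans uX_le _; rewrite ler_wpM2l// ler_wpM2r ?sqr_ge0// mulnC exprM.
by rewrite lerXn2r ?nnegrE ?norm2_ge0 ?exprn_ge0.
Qed.

(** If [s] exceeds [K], the factor [lam ^+ (2 * t)], at most [1], suffices. Otherwise either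
    [K = 0], or the criterion is the claim in logarithms, its inequality reversed because
    [ln lam < 0]. *)
Lemma cluster_criterionP (R : realType) (s Ups lam : R) (c t : nat) :
  (0 < c)%N -> 0 <= Ups -> 0 < lam < 1 -> 0 <= s ->
  cluster_criterion s c Ups lam t ->
  c%:R ^+ 3 * Ups ^+ 2 * lam ^+ (2 * t) <= s.
Proof.
move=> c_gt0 Ups_ge0 /andP[lam_gt0 lam_lt1] s_ge0 crit.
set K := c%:R ^+ 3 * Ups ^+ 2 in crit *.
have K_ge0 : 0 <= K by rewrite mulr_ge0 ?exprn_ge0.
have [sK|Ks] := leP s K; last first.
  by rewrite (le_trans _ (ltW Ks))// ler_piMr// exprn_ile1 ?ltW.
have [[-> Ups0]|[s_gt0]] := crit sK.
  by rewrite /K Ups0 expr0n mulr0 mul0r.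
have cR_gt0 : 0 < c%:R :> R by rewrite ltr0n.
have Ups_gt0 : 0 < Ups.
  rewrite lt0r Ups_ge0 andbT; apply: contraTneq (lt_le_trans s_gt0 sK) => Ups0.
  by rewrite /K Ups0 expr0n mulr0 ltxx.
have K_gt0 : 0 < K by rewrite mulr_gt0 ?exprn_gt0.
have lnK : 2 * ln (c%:R `^ (3 / 2) * Ups) = ln K.
  rewrite lnM ?posrE ?powR_gt0// ln_powR [RHS]lnM ?posrE ?exprn_gt0//.
  by rewrite (lnXn 3 cR_gt0) (lnXn 2 Ups_gt0) -2![ln _ *+ _]mulr_natl; lra.
have lnlam_lt0 : 2 * ln lam < 0 by rewrite pmulr_rlt0// ln_lt0// lam_gt0.
rewrite lnK ceil_le_int ler_ndivrMr// => ln_le.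
rewrite -ler_ln ?posrE ?mulr_gt0 ?exprn_gt0// lnM ?posrE ?exprn_gt0//.
rewrite (lnXn _ lam_gt0) -[ln lam *+ _]mulr_natl natrM.
by move: ln_le; rewrite pmulrn; lra.
Qed.

(** * Propagation of cluster errors to the server *)

Section AggregationError.
Variables (R : realType) (M J : nat) (net : network J) (cs : consensus R net).
Variables (k : nat) (wt : forall j, node net j -> 'rV[R]_M).
Hypothesis k_gt0 : (0 < k)%N.
Local Notation error n := (wt n - \sum_(m in children k n) wt m).

(** An EUT cluster has no error; a LUT cluster combines [consensus_error] with its round
    criterion. *)
Lemma cluster_error_le (j : nat) (n : node net j) (Ups s : R) :
  (j < J)%N -> consensus_valid cs -> aggregates cs k wt n ->
  (forall q q', q \in children k n -> q' \in children k n ->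
     norm2 (wt q - wt q') <= Ups) ->
  0 <= s ->
  (is_lut cs k n -> cluster_criterion s #|children k n| Ups (rate cs k n)
     (rounds cs k n)) ->
  norm2 (error n) <= Num.sqrt s.
Proof.
move=> jJ valid agg div s_ge0 crit; move: agg; rewrite /aggregates.
have [lut|_ ->] := boolP (is_lut cs k n); last first.
  by rewrite subrr norm20 sqrtr_ge0.
have [_ _ rate_itv cm] := valid k j n k_gt0 jJ lut.
case=> i ->; rewrite [X in _ - X]big_enum_val /=; set W := \matrix_(a < _) _.
have rowW a : row a W = wt (enum_val a) by rewrite rowK.
under [X in _ - X]eq_bigr => a _ do rewrite -rowW.
have Wdiv a b : norm2 (row a W - row b W) <= Ups.
  by rewrite !rowW; apply: div; exact: enum_valP.
have Ups_ge0 : 0 <= Ups by rewrite (le_trans (norm2_ge0 _) (Wdiv i i)).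
have lam_ge0 : 0 <= rate cs k n by case/andP: rate_itv => /ltW.
rewrite -(@ler_pXn2r _ 2)// ?nnegrE ?norm2_ge0 ?sqrtr_ge0// (sqr_sqrtr s_ge0).
have err_le := consensus_error (rounds cs k n) i cm lam_ge0 Wdiv.
apply: le_trans err_le _.
(* The sampled child [i] witnesses that the cluster is nonempty. *)
by apply: cluster_criterionP (crit lut) => //; exact: leq_ltn_trans (ltn_ord i).
Qed.

Lemma sum_children (j : nat) (F : node net j.+1 -> 'rV[R]_M) : (j < J)%N ->
  \sum_m F m = \sum_(n : node net j) \sum_(m in children k n) F m.
Proof.
move=> jJ; rewrite -partition_disjoint_bigcup => [|n n' nn'].
  by apply: eq_bigl => m; rewrite children_cover// finset.inE.
by rewrite -setI_eq0; apply/eqP; exact: children_disjoint.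
Qed.

(** The layer sums telescope: since clusters partition layer [j.+1], the errors at layer [j] add up
    to the difference of the sums over layers [j] and [j.+1]. *)
Lemma server_errorE :
  wt (server (net := net)) - \sum_(n : node net J) wt n =
    \sum_(j < J) \sum_(n : node net j) error n.
Proof.
have -> : wt (server (net := net)) = \sum_(n : node net 0) wt n.
  have /card_le1_eqP node0 : (#|node net 0| <= 1)%N by rewrite card_node0.
  rewrite (big_pred1 server)// => n; apply/esym/eqP; exact: node0.
have tele j : (j <= J)%N -> \sum_(n : node net 0) wt n =
    \sum_(n : node net j) wt n + \sum_(i < j) \sum_(n : node net i) error n.
  elim: j => [_|j IH jJ]; first by rewrite big_ord0 addr0.
  rewrite IH ?(ltnW jJ)// big_ord_recr /= sumrB sum_children//.
  by rewrite [RHS]addrC -addrA subrK addrC.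
by rewrite (tele J)// addrC addKr.
Qed.

Lemma server_error_le (Ups : forall j, node net j -> R) (s : nat -> R) :
  consensus_valid cs ->
  (forall j (n : node net j), (j < J)%N -> aggregates cs k wt n) ->
  (forall j (n : node net j), (j < J)%N ->
     forall q q', q \in children k n -> q' \in children k n ->
     norm2 (wt q - wt q') <= Ups j n) ->
  (forall j, (1 <= j <= J)%N -> 0 <= s j) ->
  round_criterion cs (fun _ => Ups) s k ->
  norm2 (wt (server (net := net)) - \sum_(n : node net J) wt n) ^+ 2 <=
    (\sum_(j < J) #|node net j|%:R) * \sum_(j < J) s j.+1 * #|node net j|%:R.
Proof.
move=> valid agg div s_ge0 crit; rewrite server_errorE.
have: norm2 (\sum_(j < J) \sum_(n : node net j) error n) <=
    \sum_(j < J) #|node net j|%:R * Num.sqrt (s j.+1).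
  apply: le_trans (norm2_sum _ _ _) _; apply: ler_sum => j _.
  apply: le_trans (norm2_sum _ _ _) _; rewrite mulr_natl -sumr_const.
  apply: ler_sum => n _; have jJ := ltn_ord j.
  apply: (@cluster_error_le _ _ (Ups j n)) => //; [exact: agg|exact: div| |].
    exact: s_ge0.
  exact: crit.
rewrite -(@ler_pXn2r _ 2)// ?nnegrE ?norm2_ge0//; last first.
  by apply: sumr_ge0 => j _; rewrite mulr_ge0 ?sqrtr_ge0.
(* With weights [N_j] and values [Num.sqrt (s j.+1)], the first factor is [Phi]. *)
move=> /le_trans; apply; apply: le_trans (sqr_sum_le _ _ _) _ => //.
rewrite ler_wpM2l ?sumr_ge0//; apply/ler_sum => j _.
by rewrite sqr_sqrtr ?s_ge0 ?ltn_ord// mulrC.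
Qed.

End AggregationError.

(** * Inequalities for smooth strongly convex functions *)

Section SmoothStronglyConvex.
Variables (R : realType) (M : nat) (F : 'rV[R]_M -> R) (mu eta : R).
Hypotheses (mu_gt0 : 0 < mu) (eta_gt0 : 0 < eta).
Hypotheses (F_convex : strongly_convex mu F) (F_smooth : smooth eta F).

(* Convexity alone gives the bound with constant [eta] in place of [eta / 2];
   passing through the midpoint turns a constant [c] into [c / 2 + eta / 4],
   and the iterates of this map tend to [eta / 2]. *)
Lemma descent x y :
  F y <= F x + dotp (y - x) (grad F x) + eta / 2 * norm2 (y - x) ^+ 2.
Proof.
have approx n : forall x y, F y <= F x + dotp (y - x) (grad F x) +
    (eta / 2 + eta / 2 * 2^-1 ^+ n) * norm2 (y - x) ^+ 2.
  elim: n => [|n IH] {}x {}y.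
    have gradD : dotp (y - x) (grad F y) =
        dotp (y - x) (grad F x) + dotp (y - x) (grad F y - grad F x).
      by rewrite -dotpDr subrKC.
    have := F_convex y x; rewrite -opprB dotpNl norm2N gradD expr0 => conv.
    have := dotp_le (y - x) (grad F y - grad F x).
    have := ler_wpM2l (norm2_ge0 (y - x)) (F_smooth y x).
    have : 0 <= mu / 2 * norm2 (y - x) ^+ 2.
      by rewrite mulr_ge0 ?sqr_ge0// divr_ge0// ltW.
    by move: conv; lra.
  set d := y - x; pose m := x + 2^-1 *: d.
  have mx : m - x = 2^-1 *: d by rewrite /m addrC addKr.
  have ym : y - m = 2^-1 *: d.
    apply/rowP => i; rewrite !mxE; lra.
  have := IH x m; have := IH m y; rewrite mx ym norm2Z !dotpZl.
  have -> : `|2^-1 : R| = 2^-1 by rewrite ger0_norm.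
  have gradD : dotp d (grad F m) =
      dotp d (grad F x) + dotp d (grad F m - grad F x).
    by rewrite -dotpDr subrKC.
  have := dotp_le d (grad F m - grad F x).
  have := ler_wpM2l (norm2_ge0 d) (F_smooth m x).
  rewrite gradD mx norm2Z ger0_norm// [2^-1 ^+ n.+1]exprS.
  lra.
(* Limit in [n] by contradiction: a positive gap exceeds [e / 2 ^ n] once [n] is above [e / gap],
   since [n < 2 ^ n]. *)
rewrite leNgt; apply/negP; set c := _ + _ + _ => cF.
have gap_gt0 : 0 < F y - c by rewrite subr_gt0.
set e := eta / 2 * norm2 (y - x) ^+ 2 in c cF gap_gt0.
have e_ge0 : 0 <= e by rewrite mulr_ge0 ?sqr_ge0// divr_ge0// ltW.
have := archi_boundP (divr_ge0 e_ge0 (ltW gap_gt0)); set n := Num.bound _ => en.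
have := approx n x y; rewrite mulrDl addrA -/e -/c mulrAC -/e -lerBlDl.
rewrite exprVn ler_pdivlMr ?exprn_gt0// leNgt mulrC -ltr_pdivrMr// => /negP; apply.
by rewrite (lt_trans en)// -natrX ltr_nat ltn_expl.
Qed.

(** Strong convexity times [2 * mu], with the square of [grad F x + mu *: (y - x)] completed. *)
Lemma polyak_lojasiewicz x y : 2 * mu * (F x - F y) <= norm2 (grad F x) ^+ 2.
Proof.
have := dotpp_ge0 (grad F x + mu *: (y - x)).
rewrite dotpDl !dotpDr !dotpZl !dotpZr (dotpC (grad F x) (y - x)) -!sqr_norm2.
by have := ler_wpM2l (ltW mu_gt0) (F_convex x y); lra.
Qed.

(** The step length [1 / eta] is what cancels the cross term: the linear part of [descent]
    contributes [dotp e (grad F x)], the quadratic part its opposite. *)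
Lemma perturbed_gradient_step x e :
  F (x - (1 / eta) *: grad F x + e) <=
    F x - norm2 (grad F x) ^+ 2 / (2 * eta) + eta / 2 * norm2 e ^+ 2.
Proof.
have := descent x (x - (1 / eta) *: grad F x + e).
rewrite (_ : x - _ + e - x = e - (1 / eta) *: grad F x); last first.
  by rewrite addrAC [x - _]addrC addrK addrC.
rewrite !sqr_norm2 -scaleNr !dotpDl !dotpDr !dotpZl !dotpZr (dotpC (grad F x) e).
have squareE (a b c : R) :
    eta / 2 * (c - 2 * (1 / eta) * a + (1 / eta) * (1 / eta) * b) =
    eta / 2 * c - a + b / (2 * eta) by field; rewrite gt_eqF.
have stepE (b : R) : 1 / eta * b = 2 * (b / (2 * eta)).
  by field; rewrite gt_eqF.
have := squareE (dotp e (grad F x)) (dotp (grad F x) (grad F x)) (dotp e e).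
have := stepE (dotp (grad F x) (grad F x)); lra.
Qed.

End SmoothStronglyConvex.

(** * One iteration as a perturbed gradient step *)

Lemma grad_global_loss (R : realType) (M J : nat) (net : network J)
    (data : node net J -> finType) (f : node net J -> 'rV[R]_M -> R) x :
  (forall n, differentiable (f n) x) ->
  grad (global_loss data f) x =
    (data_size R data)^-1 *: \sum_n #|data n|%:R *: grad (f n) x.
Proof.
move=> df; apply/rowP => i; rewrite !mxE summxE.
set v := delta_mx 0 i.
have dsum (r : seq (node net J)) :
    is_derive x v (fun y => \sum_(n <- r) #|data n|%:R * f n y)
      (\sum_(n <- r) (#|data n|%:R *: grad (f n) x) 0 i).
  elim: r => [|n r IH].
    rewrite big_nil (_ : (fun y => _) = cst 0); first exact: is_derive_cst.
    by apply/funext => y; rewrite big_nil.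
  rewrite big_cons (_ : (fun y => _) = #|data n|%:R *: f n +
    (fun y => \sum_(m <- r) #|data m|%:R * f m y)); last first.
    by apply/funext => y; rewrite big_cons.
  apply: is_deriveD; rewrite !mxE; apply: is_deriveZ.
  exact/derivableP/diff_derivable/df.
have := dsum (index_enum _) => ds.
have : is_derive x v (global_loss data f) ((data_size R data)^-1 *:
   (\sum_n (#|data n|%:R *: grad (f n) x) 0 i)) by apply: is_derive_eq.
by move=> dg; rewrite derive_val.
Qed.

Lemma data_size_gt0 (R : realType) (J : nat) (net : network J)
    (data : node net J -> finType) :
  (forall n, (0 < #|data n|)%N) -> 0 < data_size R data.
Proof.
move=> data_gt0; have /card_gt0P[n _] := node_nonempty net (leqnn J).
rewrite /data_size (bigD1 n)//= ltr_pwDl ?ltr0n//.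
by apply: sumr_ge0 => m _; exact: ler0n.
Qed.

(** Weighted by dataset sizes, the local steps average to an exact gradient step on [F]; what
    remains is the server error divided by [D]. *)
Lemma realization_step (R : realType) (M J : nat) (net : network J)
    (cs : consensus R net) (data : node net J -> finType)
    (f : node net J -> 'rV[R]_M -> R) (beta : R) (w : nat -> 'rV[R]_M)
    (wt : nat -> forall j, node net j -> 'rV[R]_M)
    (Ups : nat -> forall j, node net j -> R) (k : nat) (s : nat -> R) :
  let F := global_loss data f in
  let D := data_size R data in
  let Phi : R := \sum_(j < J) #|node net j|%:R in
  (forall n, (0 < #|data n|)%N) ->
  (forall n x, differentiable (f n) x) ->
  consensus_valid cs -> realization cs data f beta w wt ->
  divergence_bound wt Ups -> (0 < k)%N ->
  (forall j, (1 <= j <= J)%N -> 0 <= s j) -> round_criterion cs Ups s k ->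
  exists2 e, w k = w k.-1 - beta *: grad F (w k.-1) + e &
    norm2 e ^+ 2 <= Phi / D ^+ 2 * \sum_(j < J) s j.+1 * #|node net j|%:R.
Proof.
move=> F D Phi data_gt0 df valid real div k_gt0 s_ge0 crit.
have D_gt0 : 0 < D by exact: data_size_gt0.
have [wtJ agg wk] := real k k_gt0.
set err := wt k 0%N (server (net := net)) - \sum_(n : node net J) wt k J n.
exists (D^-1 *: err).
  rewrite wk -[wt k 0%N server](subrK (\sum_(n : node net J) wt k J n)).
  rewrite -/err -/D addrC scalerDr; congr (_ + _).
  under eq_bigr => n _ do rewrite wtJ scalerBr scalerA mulrC -scalerA.
  rewrite sumrB -scaler_suml -scaler_sumr -/(data_size R data) -/D.
  rewrite scalerBr scalerA mulVf ?gt_eqF// scale1r /F grad_global_loss//.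
  by rewrite scalerA mulrC -scalerA.
have := server_error_le k_gt0 valid agg (fun j n => div k j n k_gt0) s_ge0 crit.
rewrite norm2Z exprMn real_normK ?num_real// -/err => err_le.
by rewrite exprVn mulrAC [leRHS]mulrC ler_wpM2l// invr_ge0 exprn_ge0// ltW.
Qed.

(** * Contraction and iteration count *)

Lemma affine_recursion_le (R : realDomainType) (a A : R) (u : nat -> R) n :
  0 <= a -> (forall k, u k.+1 - A <= a * (u k - A)) ->
  u n - A <= a ^+ n * (u 0%N - A).
Proof.
move=> a_ge0 uS; elim: n => [|n IH]; first by rewrite mul1r.
by rewrite (le_trans (uS n))// exprS -mulrA ler_wpM2l.
Qed.

Lemma ceil_log_leP (R : realType) (x y a : R) (n : nat) :
  0 < a < 1 -> 0 < y -> ceil_log_le x (ln y) (ln a) n -> a ^+ n * y <= x.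
Proof.
move=> /andP[a_gt0 a_lt1] y_gt0 [x_gt0].
have lna_lt0 : ln a < 0 by rewrite ln_lt0// a_gt0.
rewrite ceil_le_int ler_ndivrMr// -pmulrn => ln_le.
rewrite -ler_ln ?posrE ?mulr_gt0 ?exprn_gt0// lnM ?posrE ?exprn_gt0//.
by rewrite (lnXn _ a_gt0) -[ln a *+ _]mulr_natl; lra.
Qed.

Theorem corollary2 (R : realType) (M J : nat) (J_gt0 : (0 < J)%N)
  (net : network J) (cs : consensus R net)
  (data : node net J -> finType)
  (data_nonempty : forall n, (0 < #|data n|)%N)
  (f : node net J -> 'rV[R]_M -> R)
  (f_differentiable : forall n x, differentiable (f n) x)
  (mu eta beta : R) (wstar : 'rV[R]_M)
  (w : nat -> 'rV[R]_M) (wt : nat -> forall j, node net j -> 'rV[R]_M)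
  (Ups : nat -> forall j, node net j -> R)
  (kappa : nat) (eps : R) :
  let F := global_loss data f in
  let D := data_size R data in
  let gap := F (w 0%N) - F wstar in
  let Phi : R := \sum_(j < J) #|node net j|%:R in
  0 < mu < eta ->
  strongly_convex mu F ->
  smooth eta F ->
  (forall x, F wstar <= F x) ->
  consensus_valid cs ->
  beta = 1 / eta ->
  realization cs data f beta w wt ->
  divergence_bound wt Ups ->
  (1 <= kappa)%N ->
  (1 - mu / eta) ^+ kappa * gap <= eps < gap ->
  (forall sigma : nat -> R,
     let A := eta ^+ 2 * Phi / (2 * mu * D ^+ 2) *
              \sum_(j < J) sigma j.+1 * #|node net j|%:R in
     (forall j, (1 <= j <= J)%N -> 0 <= sigma j) ->
     (forall k, (1 <= k)%N -> round_criterion cs Ups sigma k) ->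
     A <= eps ->
     ceil_log_le (eps - A) (ln (gap - A)) (ln (1 - mu / eta)) kappa ->
     F (w kappa) - F wstar <= eps) /\
  (forall (delta : R) (sigma : nat -> nat -> R),
     0 < delta <= mu / eta ->
     (forall k j, (1 <= k)%N -> (1 <= j <= J)%N -> 0 <= sigma k j) ->
     (forall k, (1 <= k)%N ->
        \sum_(j < J) sigma k j.+1 * #|node net j|%:R <=
          D ^+ 2 * mu * (mu - delta * eta) / (eta ^+ 4 * Phi) *
          norm2 (grad F (w k.-1)) ^+ 2) ->
     (forall k, (1 <= k)%N -> round_criterion cs Ups (sigma k) k) ->
     ceil_log_le eps (ln gap) (ln (1 - delta)) kappa ->
     F (w kappa) - F wstar <= eps).
Proof.
move=> F D gap Phi /andP[mu_gt0 mu_lt] F_convex F_smooth wstar_min valid.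
move=> beta_eq real div kappa_gt0 /andP[_ eps_lt].
have eta_gt0 : 0 < eta by exact: lt_trans mu_lt.
have D_gt0 : 0 < D by exact: data_size_gt0.
have r_gt0 : 0 < mu / eta by rewrite divr_gt0.
have r_lt1 : mu / eta < 1 by rewrite ltr_pdivrMr// mul1r.
have Phi_gt0 : 0 < Phi.
  rewrite /Phi (bigD1 (Ordinal J_gt0))//= card_node0 ltr_pwDl//.
  by apply: sumr_ge0 => j _; exact: ler0n.
have step (s : nat -> R) k : (forall j, (1 <= j <= J)%N -> 0 <= s j) ->
    round_criterion cs Ups s k.+1 ->
    F (w k.+1) <= F (w k) - norm2 (grad F (w k)) ^+ 2 / (2 * eta) +
      eta / 2 * (Phi / D ^+ 2 * \sum_(j < J) s j.+1 * #|node net j|%:R).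
  move=> s_ge0 crit.
  have [e -> e_le] :=
    realization_step data_nonempty f_differentiable valid real div
      (ltn0Sn k) s_ge0 crit.
  rewrite beta_eq.
  apply: le_trans (perturbed_gradient_step mu_gt0 eta_gt0 F_convex F_smooth _ _) _.
  by rewrite lerD2l ler_wpM2l// divr_ge0// ltW.
have PL k : mu / eta * (F (w k) - F wstar) <=
    norm2 (grad F (w k)) ^+ 2 / (2 * eta).
  rewrite ler_pdivlMr ?mulr_gt0//.
  have -> (b : R) : mu / eta * b * (2 * eta) = 2 * mu * b.
    by field; rewrite gt_eqF.
  exact: (polyak_lojasiewicz mu_gt0 F_convex).
split=> [sigma A s_ge0 crit A_le eps_log
        |delta sigma /andP[d_gt0 d_le] s_ge0 s_le crit eps_log].
  (* From [A <= eps < gap]; positivity makes [ln (gap - A)] a genuine logarithm. *)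
  have gapA_gt0 : 0 < gap - A by rewrite subr_gt0 (le_lt_trans A_le).
  have r_itv : 0 < 1 - mu / eta < 1 by apply/andP; split; lra.
  rewrite -(lerD2r (- A)).
  apply: le_trans (ceil_log_leP r_itv gapA_gt0 eps_log).
  apply: (@affine_recursion_le _ _ _ (fun k => F (w k) - F wstar)) => [|k]; first lra.
  have := step sigma k s_ge0 (crit k.+1 isT); have := PL k.
  (* The noise is [r * A] with [r = mu / eta], so [A] is the fixed point of the recursion with
     factor [1 - r]. *)
  have -> : eta / 2 * (Phi / D ^+ 2 *
      \sum_(j < J) sigma j.+1 * #|node net j|%:R) = mu / eta * A.
    by rewrite /A; field; rewrite !gt_eqF.
  by move: (mu / eta) => r; lra.
have d_itv : 0 < 1 - delta < 1 by apply/andP; split; lra.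
have gap_gt0 : 0 < gap by apply: lt_trans eps_lt; case: eps_log.
apply: le_trans (ceil_log_leP d_itv gap_gt0 eps_log).
(* Here the noise is absorbed by the gradient term, so the recursion has fixed point [0]. *)
rewrite -[leLHS]subr0 -[gap]subr0.
apply: (@affine_recursion_le _ _ _ (fun k => F (w k) - F wstar)) => [|k]; first lra.
have := step (sigma k.+1) k (s_ge0 k.+1 ^~ isT) (crit k.+1 isT); have := PL k.
have := s_le k.+1 isT; rewrite /=; set S := \sum_(j < J) _ => S_le.
set g := norm2 _ ^+ 2 / (2 * eta); set gk := F (w k) - F wstar => PLk stepk.
have noise_le : eta / 2 * (Phi / D ^+ 2 * S) <=
    mu / eta * (mu / eta - delta) * g.
  have c_ge0 : 0 <= eta / 2 * (Phi / D ^+ 2).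
    by rewrite !mulr_ge0// ?invr_ge0 ?exprn_ge0// ltW.
  rewrite mulrA; apply: le_trans (ler_wpM2l c_ge0 S_le) _.
  rewrite /g le_eqVlt; apply/orP; left; apply/eqP.
  by field; rewrite !gt_eqF.
move: (mu / eta) r_gt0 r_lt1 d_le PLk noise_le => r r_gt0 r_lt1 d_le PLk noise_le.
have gk_ge0 : 0 <= gk by rewrite subr_ge0.
(* With [r = mu / eta], the loss decreases by at least
   [(1 - r (r - delta)) g >= (1 - r (r - delta)) r gk >= delta gk]. *)
have r2_ge0 : 0 <= r * (r - delta) by rewrite mulr_ge0 ?subr_ge0// ltW.
have r2_le1 : 0 <= 1 - r * (r - delta).
  have : r * (r - delta) <= 1 * 1.
    by apply: ler_pM; rewrite ?subr_ge0//; lra.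
  lra.
have := ler_wpM2l r2_le1 PLk.
(* This is the slack [(1 - r * (r - delta)) * r - delta], factored, times [gk]. *)
have : 0 <= (r - delta) * (1 - r ^+ 2) * gk.
  apply: mulr_ge0 gk_ge0; apply: mulr_ge0; rewrite subr_ge0//.
  by rewrite exprn_ile1 ?ltW.
by move: stepk noise_le; rewrite /gk; lra.
Qed.
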